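(* Suppose that Assumption $(L)$-a.e. holds for the trajectory set $\mathcal{S}$. Let $(f_i)_{i\ge0}$ be a supermartingale with values in $[0,\infty)$, and suppose the following condition on $\mathcal{S}$: whenever $(S,j)$ is an up-down node such that $(L_{(S,j)})$ holds and $(L_{(S,j+1)})$ fails, there are $S^1,S^0\in\mathcal{S}_{(S,j)}$ such that $S^1_{j+1}\ge S_{j+1}\ge S^0_{j+1}$ and $(L_{(S^\iota,j+1)})$ holds for $\iota=0,1$. Then there exists a null set $\mathcal{N}_{div}\subseteq\mathcal{S}$ such that $\lim_{i\to\infty}f_i(S)$ exists in $\mathbb{R}$ for every $S\in\mathcal{S}\setminus\mathcal{N}_{div}$.
   Context: Trajectories and nodes. Fix $s_0\in\mathbb{R}$ and a trajectory set $\mathcal{S}$, i.e. a set of real sequences $S=(S_i)_{i\ge 0}$ with $S_0=s_0$. For $S\in\mathcal{S}$ and $j\ge 0$ let $\mathcal{S}_{(S,j)}=\{\tilde S\in\mathcal{S}:\tilde S_i=S_i,\ 0\le i\le j\}$; the pair $(S,j)$ (identified with $\mathcal{S}_{(S,j)}$) is called a node. Write $\Delta_iS=S_{i+1}-S_i$. A node $(S,j)$ is an up-down node if $\sup_{\tilde S\in\mathcal{S}_{(S,j)}}(\tilde S_{j+1}-S_j)>0$ and $\inf_{\tilde S\in\mathcal{S}_{(S,j)}}(\tilde S_{j+1}-S_j)<0$. A sequence $(f_j)_{j\ge0}$ of functions on $\mathcal{S}$ is non-anticipative if $f_j(S)=f_j(\tilde S)$ whenever $S_i=\tilde S_i$ for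 $0\le i\le j$. Portfolios. $\mathcal{H}_{(S,j)}$ is the set of sequences $H=(H_i)_{i\ge j}$ of functions $H_i:\mathcal{S}_{(S,j)}\to\mathbb{R}$ such that $H_i(\tilde S)=H_i(\hat S)$ whenever $\tilde S_k=\hat S_k$ for $j\le k\le i$ (no measurability is required). For $V\in\mathbb{R}$, $H\in\mathcal{H}_{(S,j)}$, $n\ge j$, put $\Pi_{j,n}^{V,H}(\tilde S)=V+\sum_{i=j}^{n-1}H_i(\tilde S)\Delta_i\tilde S$ for $\tilde S\in\mathcal{S}_{(S,j)}$. $\mathcal{E}_{(S,j)}$ is the vector space of all functions $\Pi_{j,n}^{V,H}$ on $\mathcal{S}_{(S,j)}$ ($V\in\mathbb{R}$, $H\in\mathcal{H}_{(S,j)}$, $n$ an integer $\ge j$), and $\mathcal{E}_{(S,j)}^+$ is the set of its nonnegative elements. Operators. $Q$ is the set of all functions $\mathcal{S}\to[-\infty,\infty]$ and $P$ the set of all functions $\mathcal{S}\to[0,\infty]$. Conventions: $0\cdot\infty=0$, $\infty+(-\infty)=\infty$, $u-v=u+(-v)$, $\inf\emptyset=\infty$. For $f\in P$, $\overline{I}_jf(S)$ is the infimum of all $\sum_{m\ge1}V^m$ for which there are $H^m\in\mathcal{H}_{(S,j)}$ with $\Pi_{j,n}^{V^m,H^m}\in\mathcal{E}^+_{(S,j)}$ for all $n\ge j$, $m\ge 1$, and $f\le\sum_{m\ge1}\liminf_{n\to\infty}\Pi_{j,n}^{V^m,H^m}$ on $\mathcal{S}_{(S,j)}$. Write $\overline{I}=\overline{I}_0$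 (a constant). $E\subseteq\mathcal{S}$ is a null set if $\overline{I}(\mathbf{1}_E)=0$; a property holds a.e. if it fails only on a null set. For $f\in Q$, $\overline{\sigma}_jf(S)$ is the infimum of all $\sum_{m\ge0}V^m$ for which $f\le\sum_{m\ge0}f_m$ on $\mathcal{S}_{(S,j)}$, where $f_0=\Pi_{j,n_0}^{V^0,H^0}\in\mathcal{E}_{(S,j)}$ for some $n_0$ and, for $m\ge1$, $f_m=\liminf_{n\to\infty}\Pi_{j,n}^{V^m,H^m}$ with $\Pi_{j,n}^{V^m,H^m}\in\mathcal{E}^+_{(S,j)}$ for all $n\ge j$. Supermartingale: a non-anticipative sequence $(f_j)_{j\ge0}$ in $Q$ with $\overline{\sigma}_jf_{j+1}\le f_j$ a.e. for every $j\ge0$. Property $(L_{(S,j)})$: whenever $f=\Pi_{j,n_f}^{V,H}\in\mathcal{E}_{(S,j)}$ and $f_m=\liminf_{n\to\infty}\Pi_{j,n}^{V^m,H^m}$ with $\Pi_{j,n}^{V^m,H^m}\in\mathcal{E}^+_{(S,j)}$ for all $n\ge j$, $m\ge1$, satisfy $f\le\sum_{m\ge1}f_m$ on $\mathcal{S}_{(S,j)}$, then $V\le\sum_{m\ge1}V^m$. Property $(L)$ is $(L_{(S,0)})$ (independent of $S$). Assumption $(L)$-a.e. means: $(L)$ holds, and $\{S\in\mathcal{S}:\exists j\ge0\text{ such that }(L_{(S,j)})\text{ fails}\}$ is a null set. *)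

(* Defs.v *)
From mathcomp Require Import all_boot all_order all_algebra.
From mathcomp Require Import all_classical all_reals all_analysis.

Set Implicit Arguments.
Unset Strict Implicit.
Unset Printing Implicit Defensive.

Import Order.TTheory GRing.Theory Num.Theory.
Import numFieldNormedType.Exports.

Local Open Scope classical_set_scope.
Local Open Scope ring_scope.
Local Open Scope ereal_scope.

(** Functions on the trajectory set [Tr], or on a node of it, are represented
    by total functions on [nat -> R]; every condition below is only imposed on
    trajectories, so the values taken elsewhere are irrelevant.  Sequences
    indexed by [m >= 1] are total sequences whose term of index 0 is ignored
    (or plays the role of the term m = 0, in [sigma_bar]). *)

Section Trajectories.
Context {R : realType}.
Variable Tr : set (nat -> R).

Implicit Types (S T : nat -> R) (i j n : nat) (V : R).
Implicit Types (H : nat -> (nat -> R) -> R).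

Definition node S j : set (nat -> R) :=
  [set T | Tr T /\ forall i, (i <= j)%N -> T i = S i].

Definition up_down S j : Prop :=
  0 < ereal_sup [set (T j.+1 - S j)%:E | T in node S j] /\
  ereal_inf [set (T j.+1 - S j)%:E | T in node S j] < 0.

Definition non_anticipative (f : nat -> (nat -> R) -> \bar R) : Prop :=
  forall j S T, Tr S -> Tr T ->
    (forall i, (i <= j)%N -> S i = T i) -> f j S = f j T.

Definition portfolio S j H : Prop :=
  forall i T T', (j <= i)%N -> node S j T -> node S j T' ->
    (forall k, (j <= k <= i)%N -> T k = T' k) -> H i T = H i T'.

Definition wealth j n V H T : R :=
  (V + \sum_(j <= i < n) H i T * (T i.+1 - T i))%R.

Definition elementary S j (f : (nat -> R) -> R) : Prop :=
  exists V H n, [/\ portfolio S j H, (j <= n)%N &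
    forall T, node S j T -> f T = wealth j n V H T].

Definition elementary_nneg S j (f : (nat -> R) -> R) : Prop :=
  elementary S j f /\ forall T, node S j T -> (0 <= f T)%R.

Definition admissible S j V H : Prop :=
  portfolio S j H /\
  forall n, (j <= n)%N -> elementary_nneg S j (wealth j n V H).

Definition liminf_wealth j V H T : \bar R :=
  limn_einf (fun n => (wealth j n V H T)%:E).

Definition I_bar j (f : (nat -> R) -> \bar R) S : \bar R :=
  ereal_inf [set x | exists (V : nat -> R) (H : nat -> nat -> (nat -> R) -> R),
    [/\ forall m, (1 <= m)%N -> admissible S j (V m) (H m),
        forall T, node S j T ->
          f T <= \sum_(1 <= m <oo) liminf_wealth j (V m) (H m) T
      & x = \sum_(1 <= m <oo) (V m)%:E]].

(** In both sums the term m = 0 is finite and, on a node, the remaining terms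
    are nonnegative, so that no indeterminate sum occurs. *)
Definition sigma_bar j (f : (nat -> R) -> \bar R) S : \bar R :=
  ereal_inf [set x | exists (V : nat -> R) (H : nat -> nat -> (nat -> R) -> R)
                            (n0 : nat),
    [/\ portfolio S j (H 0%N) /\ (j <= n0)%N,
        forall m, (1 <= m)%N -> admissible S j (V m) (H m),
        forall T, node S j T ->
          f T <= (wealth j n0 (V 0%N) (H 0%N) T)%:E
                 + \sum_(1 <= m <oo) liminf_wealth j (V m) (H m) T
      & x = (V 0%N)%:E + \sum_(1 <= m <oo) (V m)%:E]].

(** [I_bar 0 f] is constant on [Tr], since [node S 0 = Tr] for [S] in [Tr]. *)
Definition I_null (E : set (nat -> R)) : Prop :=
  E `<=` Tr /\
  forall S, Tr S -> I_bar 0 (fun T => (\1_E T)%:E) S = 0.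

Definition I_ae (P : (nat -> R) -> Prop) : Prop :=
  I_null [set S | Tr S /\ ~ P S].

Definition supermartingale (f : nat -> (nat -> R) -> \bar R) : Prop :=
  non_anticipative f /\
  forall j, I_ae (fun S => sigma_bar j (f j.+1) S <= f j S).

Definition propL S j : Prop :=
  forall V H n (Vs : nat -> R) (Hs : nat -> nat -> (nat -> R) -> R),
    portfolio S j H -> (j <= n)%N ->
    (forall m, (1 <= m)%N -> admissible S j (Vs m) (Hs m)) ->
    (forall T, node S j T ->
      (wealth j n V H T)%:E
        <= \sum_(1 <= m <oo) liminf_wealth j (Vs m) (Hs m) T) ->
    V%:E <= \sum_(1 <= m <oo) (Vs m)%:E.

Definition L_ae : Prop :=
  (forall S, Tr S -> propL S 0) /\
  I_ae (fun S => forall j, propL S j).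

End Trajectories.

(* Main.v *)
Require Import Defs.
From mathcomp Require Import all_boot all_order all_algebra.
From mathcomp Require Import all_classical all_reals all_analysis.
From mathcomp Require Import ring lra.

(** The argument is Doob's: trading against the upcrossings of a nonnegative
    supermartingale [f] yields a wealth that never becomes negative, starts from
    a finite capital and explodes wherever [f] crosses an interval infinitely
    often.  By scaling the wealth down, the set of explosion is superhedged at an
    arbitrarily small cost, hence null ([I_null_of_explosion]).  Holding [f]
    forever disposes in the same way of the trajectories along which [f] tends
    to infinity.

    To hold [f] over one step one needs a position [h] with
    [f_{j+1} <= f_j + e + h * (S_{j+1} - S_j)] at the next step, whereas the
    supermartingale inequality only supplies a superhedge by countably many
    portfolios with an infinite horizon.  The passage rests on three points.
    - At a child where (L) holds, (L) allows every portfolio of the superhedge to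
      be stopped on arrival ([propL_subnode]).  What remains is a countable sum
      of one-step wealths.
    - At an up-down node the positions of admissible portfolios are bounded by a
      multiple of their capitals ([up_down_position_bound]), so they can be
      summed into a single position ([one_step_hedge]).  At any other node the
      next move is almost everywhere flat, because a bet on the only possible
      direction is a free gain ([I_null_one_sided_moves]).
    - At a child of an up-down node where (L) fails, the increment lies between
      those of two children where (L) holds.  There the affine bound dominates
      [f >= 0], so it is nonnegative in between too
      ([hedging_position_exists]).  Such a child belongs to a null set, so
      nonnegativity is enough: trading stops there, without debt.

    The tolerances [e] are chosen summable and are paid for by one additional
    unit of initial capital ([strategy_wealth]). *)

Import Order.TTheory GRing.Theory Num.Theory.
Import numFieldNormedType.Exports.

Local Open Scope classical_set_scope.
Local Open Scope ring_scope.
Local Open Scope ereal_scope.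

Set Implicit Arguments.
Unset Strict Implicit.
Unset Printing Implicit Defensive.

(** * Series and lower limits *)

Section SeriesPrelim.
Context {R : realType}.
Implicit Types (u v : (\bar R)^nat) (x y : R^nat).

Lemma eseries_shift1 u :
  \sum_(1 <= m <oo) u m = \sum_(0 <= m <oo) u m.+1.
Proof.
rewrite /lim /lim_in; congr get; apply/funext => l; apply/propext.
rewrite -(cvg_shiftS (fun n => \sum_(1 <= m < n) u m)) /=.
by under [X in X @ _ --> _ <-> _]eq_fun do rewrite big_add1 /=.
Qed.

Lemma limn_einf_near u v :
  (\forall n \near \oo, u n = v n) -> limn_einf u = limn_einf v.
Proof.
move=> [N _ uv]; rewrite !limn_einf_lim.
have E : \forall n \near \oo, einfs v n = einfs u n.
  exists N => // n /= Nn; congr ereal_inf; apply/seteqP.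
  by split=> _ [m /= nm <-]; exists m => //; rewrite uv //=; exact: leq_trans nm.
apply/cvg_lim => //; apply: cvg_trans (near_eq_cvg E) _.
exact: is_cvg_einfs.
Qed.

Lemma limn_einf_ge u (l : \bar R) :
  (\forall n \near \oo, l <= u n) -> l <= limn_einf u.
Proof.
move=> [N _ lu]; rewrite limn_einf_lim; apply: lime_ge; first exact: is_cvg_einfs.
exists N => // n /= Nn; apply: le_ereal_inf_tmp => _ [m /= nm <-].
by apply: lu => /=; exact: leq_trans nm.
Qed.

Lemma cvg_series_of_nneseries x :
  (forall m, (0 <= x m)%R) -> \sum_(0 <= m <oo) (x m)%:E < +oo ->
  series x @ \oo --> fine (\sum_(0 <= m <oo) (x m)%:E).
Proof.
move=> x0 xoo.
have cx : cvgn (fun n => \sum_(0 <= m < n) (x m)%:E).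
  by apply: is_cvg_nneseries => n _ _; rewrite lee_fin.
have fx : \sum_(0 <= m <oo) (x m)%:E \is a fin_num.
  by rewrite ge0_fin_numE//; apply: nneseries_ge0 => n _ _; rewrite lee_fin.
move: cx; rewrite cvg_ex /= => -[l fl]; have Ll := cvg_lim _ fl; move: fl.
rewrite -{}Ll// -[X in _ --> X -> _](fineK fx) => /fine_cvgP[_].
rewrite (_ : fine \o _ = series x)//.
by apply/funext => n; rewrite /series /= sumEFin.
Qed.

Lemma eseries_affine x y (l k d : R) :
  series x @ \oo --> l -> series y @ \oo --> k ->
  \sum_(0 <= m <oo) (x m + y m * d)%:E = (l + k * d)%:E.
Proof.
move=> xl yk; apply/cvg_lim => //.
under eq_fun do rewrite sumEFin.
apply: cvg_EFin; first by apply: nearW.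
under eq_fun do rewrite /= big_split /= -mulr_suml.
by apply: cvgD => //; apply: cvgMl.
Qed.

End SeriesPrelim.

(** * Nodes and portfolios *)

Section Nodes.
Context {R : realType}.
Variable Tr : set (nat -> R).
Implicit Types (S T : nat -> R) (H : nat -> (nat -> R) -> R) (V : R).

Lemma node_self S j : Tr S -> node Tr S j S.
Proof. by []. Qed.

Lemma node_eq S T j i : node Tr S j T -> (i <= j)%N ->
  node Tr T i = node Tr S i.
Proof.
move=> [_ ST] ij; apply/seteqP; split=> U [TU eU]; split=> // k ki.
  by rewrite eU// ST// (leq_trans ki).
by rewrite eU// ST// (leq_trans ki).
Qed.

Lemma sub_node S j k : (j <= k)%N -> node Tr S k `<=` node Tr S j.
Proof. by move=> jk T [TT eT]; split=> // i ij; exact/eT/(leq_trans ij). Qed.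

Lemma node_trans S T j : node Tr S j T -> node Tr T j `<=` node Tr S j.
Proof. by move=> ST U; rewrite (node_eq ST). Qed.

(** What is attached to a node depends on the trajectory representing it only
    through the node as a set.  Stating this as equalities makes positions that
    are chosen by the axiom of choice non-anticipative. *)
Section NodeInvariance.
Variables (S T : nat -> R) (j : nat).
Hypothesis nodeST : node Tr T j = node Tr S j.

Let portfolioE : portfolio Tr T j = portfolio Tr S j.
Proof. by rewrite /portfolio nodeST. Qed.

Let admissibleE : admissible Tr T j = admissible Tr S j.
Proof.
by rewrite /admissible /elementary_nneg /elementary portfolioE nodeST.
Qed.

Lemma propL_node : propL Tr T j = propL Tr S j.
Proof. by rewrite /propL portfolioE admissibleE nodeST. Qed.

Lemma sigma_bar_node f : sigma_bar Tr j f T = sigma_bar Tr j f S.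
Proof. by rewrite /sigma_bar portfolioE admissibleE nodeST. Qed.

Lemma up_down_node : T j = S j -> up_down Tr T j = up_down Tr S j.
Proof. by rewrite /up_down nodeST => ->. Qed.

End NodeInvariance.

Lemma wealth_cat j k n V H T : (j <= k)%N -> (k <= n)%N ->
  wealth j n V H T = wealth k n (wealth j k V H T) H T.
Proof. by move=> jk kn; rewrite /wealth (big_cat_nat jk kn) addrA. Qed.

Lemma wealth0 j V H T : wealth j j V H T = V.
Proof. by rewrite /wealth big_geq ?addr0. Qed.

Lemma wealthS j n V H T : (j <= n)%N ->
  (wealth j n.+1 V H T = wealth j n V H T + H n T * (T n.+1 - T n))%R.
Proof. by move=> jn; rewrite /wealth big_nat_recr//= addrA. Qed.

Lemma wealth_scale j n (a : R) V H T :
  (wealth j n (a * V) (fun i U => a * H i U) T = a * wealth j n V H T)%R.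
Proof.
by rewrite /wealth mulrDr mulr_sumr; under eq_bigr do rewrite -mulrA.
Qed.

(** A wealth process is elementary by its very form, so only its sign remains to
    be checked. *)
Lemma admissibleP S j V H : portfolio Tr S j H ->
  (forall n T, (j <= n)%N -> node Tr S j T -> (0 <= wealth j n V H T)%R) ->
  admissible Tr S j V H.
Proof.
move=> pH w0; split=> // n jn; split; last by move=> T; exact: w0.
by exists V, H, n.
Qed.

Lemma admissible_wealth_ge0 S j V H n T : admissible Tr S j V H ->
  (j <= n)%N -> node Tr S j T -> (0 <= wealth j n V H T)%R.
Proof. by move=> [_ /(_ n)] H0 /H0[_]; apply. Qed.

Lemma admissible_ge0 S j V H : Tr S -> admissible Tr S j V H -> (0 <= V)%R.
Proof.
move=> TS /(@admissible_wealth_ge0 _ _ _ _ j S) /(_ (leqnn _)).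
by rewrite wealth0; apply; exact: node_self.
Qed.

Lemma liminf_wealth_ge0 S j V H T : admissible Tr S j V H ->
  node Tr S j T -> 0 <= liminf_wealth j V H T.
Proof.
move=> aH ST; apply: limn_einf_ge; exists j => // n /= jn.
by rewrite lee_fin; exact: (admissible_wealth_ge0 aH).
Qed.

Lemma admissible_scale S j (a : R) V H : (0 <= a)%R ->
  admissible Tr S j V H ->
  admissible Tr S j (a * V)%R (fun i T => (a * H i T)%R).
Proof.
move=> a0 aH; apply: admissibleP.
  move=> i T T' ji ST ST' TT'; congr (_ * _)%R; exact: (aH.1 i).
move=> n T jn ST; rewrite wealth_scale mulr_ge0//.
exact: (admissible_wealth_ge0 aH).
Qed.

Lemma admissible_zero S j : admissible Tr S j 0%R (fun _ _ => 0%R).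
Proof.
apply: admissibleP => // n T _ _; rewrite /wealth big1 ?addr0// => i _.
by rewrite mul0r.
Qed.

Lemma portfolio_subnode S j k T H : (j <= k)%N -> node Tr S j T ->
  portfolio Tr S j H -> portfolio Tr T k H.
Proof.
move=> jk ST pH i U U' ki [TU eU] [TU' eU'] UU'.
apply: pH; first exact: leq_trans ki.
- by apply: (node_trans ST); apply: (sub_node jk); split.
- by apply: (node_trans ST); apply: (sub_node jk); split.
move=> l /andP[jl li]; case: (leqP l k) => lk; first by rewrite eU// eU'.
by apply: UU'; rewrite li (ltnW lk).
Qed.

Lemma wealth_subnode S j k V H T U : (j <= k)%N -> portfolio Tr S j H ->
  node Tr S j T -> node Tr T k U -> wealth j k V H U = wealth j k V H T.
Proof.
move=> jk pH ST TU; rewrite /wealth; congr (_ + _)%R.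
apply: eq_big_nat => i /andP[ji ik]; have TT := ST.1.
have eU l : (l <= k)%N -> U l = T l by exact: TU.2.
rewrite !eU//; last exact: ltnW.
congr (_ * _)%R; apply: pH => //.
  exact/(node_trans ST)/(sub_node jk).
by move=> l /andP[_ li]; rewrite eU// (leq_trans li)// ltnW.
Qed.

Lemma admissible_subnode S j k V H T : (j <= k)%N -> node Tr S j T ->
  admissible Tr S j V H -> admissible Tr T k (wealth j k V H T) H.
Proof.
move=> jk ST aH; apply: admissibleP; first exact: portfolio_subnode ST aH.1.
move=> n U kn TU; rewrite -(wealth_subnode V jk aH.1 ST TU) -wealth_cat//.
apply: (admissible_wealth_ge0 aH); first exact: leq_trans kn.
exact/(node_trans ST)/(sub_node jk).
Qed.

Lemma liminf_wealth_subnode S j k V H T U : (j <= k)%N ->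
  portfolio Tr S j H -> node Tr S j T -> node Tr T k U ->
  liminf_wealth j V H U = liminf_wealth k (wealth j k V H T) H U.
Proof.
move=> jk pH ST TU; apply: limn_einf_near; exists k => // n /= kn.
by rewrite (wealth_cat _ _ _ jk kn) (wealth_subnode V jk pH ST TU).
Qed.

(** The property (L), applied at a later node, turns a superhedge of a
    constant over the whole future of that node into an inequality between
    the wealths on arrival at it. *)
Lemma propL_subnode S j k n T (c V : R) H (Vs : R^nat)
    (Hs : nat -> nat -> (nat -> R) -> R) :
  (j <= k)%N -> (k <= n)%N -> node Tr S j T -> propL Tr T k ->
  portfolio Tr S j H ->
  (forall m, admissible Tr S j (Vs m) (Hs m)) ->
  (forall U, node Tr T k U -> c%:E <= (wealth j n V H U)%:E
     + \sum_(0 <= m <oo) liminf_wealth j (Vs m) (Hs m) U) ->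
  (c - wealth j k V H T)%:E
    <= \sum_(0 <= m <oo) (wealth j k (Vs m) (Hs m) T)%:E.
Proof.
move=> jk kn ST LT pH aHs hedge.
have := LT (c - wealth j k V H T)%R (fun i U => - H i U)%R n
  (fun m => wealth j k (Vs m.-1) (Hs m.-1) T) (fun m => Hs m.-1).
rewrite eseries_shift1; apply=> //.
- move=> i U U' ki TU TU' UU'; congr (- _)%R.
  exact: (portfolio_subnode jk ST pH ki).
- by move=> m _; exact: admissible_subnode jk ST (aHs _).
move=> U TU; rewrite eseries_shift1 /=.
under eq_eseriesr do rewrite -(liminf_wealth_subnode _ jk (aHs _).1 ST TU).
have -> : wealth k n (c - wealth j k V H T) (fun i W => - H i W)%R U
    = (c - wealth j n V H U)%R.
  rewrite (wealth_cat _ _ _ jk kn) (wealth_subnode V jk pH ST TU).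
  move: (wealth j k V H T) => w; rewrite /wealth opprD addrA -sumrN.
  by congr (_ + _)%R; apply: eq_bigr => i _; rewrite mulNr.
by rewrite EFinB leeBlDl//; exact: hedge.
Qed.

(** A finite-horizon position can be kept idle after its horizon, so that the
    horizon may be chosen as late as one likes. *)
Lemma extend_horizon S j n V H : portfolio Tr S j H -> (j <= n)%N ->
  exists2 H', portfolio Tr S j H' &
    forall n' U, (n <= n')%N -> wealth j n' V H' U = wealth j n V H U.
Proof.
move=> pH jn; exists (fun i U => if (i < n)%N then H i U else 0%R).
  by move=> i U U' ji SU SU' UU'; case: ifP => // _; exact: pH.
move=> n' U nn'; rewrite (wealth_cat _ _ _ jn nn') {1}/wealth.
rewrite (eq_big_nat _ _ (F2 := fun=> 0%R)); last first.
  by move=> i /andP[ni _]; rewrite ltnNge ni mul0r.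
rewrite big1_eq addr0 /wealth; congr (_ + _)%R.
by apply: eq_big_nat => i /andP[_ ->].
Qed.

End Nodes.

(** * Null sets *)

Section NullSets.
Context {R : realType}.
Variable (s0 : R) (Tr : set (nat -> R)).
Hypothesis Tr_s0 : forall S, Tr S -> S 0%N = s0.
Implicit Types (S T : nat -> R) (H : nat -> (nat -> R) -> R) (V : R).
Implicit Types (E : set (nat -> R)).

Lemma node0 S : Tr S -> node Tr S 0 = Tr.
Proof.
move=> TS; apply/seteqP; split=> [T []//|T TT]; split=> // i.
by rewrite leqn0 => /eqP->; rewrite !Tr_s0.
Qed.

(** The portfolios are indexed from 0 here, which spares the case distinctions
    on the index when families of portfolios are merged. *)
Definition covered S E (e : R) : Prop :=
  exists (Vs : R^nat) (Hs : nat -> nat -> (nat -> R) -> R),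
    [/\ forall m, admissible Tr S 0 (Vs m) (Hs m),
        forall T, Tr T -> E T ->
          1 <= \sum_(0 <= m <oo) liminf_wealth 0 (Vs m) (Hs m) T
      & \sum_(0 <= m <oo) (Vs m)%:E <= e%:E].

Lemma I_nullP E : I_null Tr E <->
  E `<=` Tr /\ forall S e, Tr S -> (0 < e)%R -> covered S E e.
Proof.
split=> -[ETr nullE]; split=> // S.
  move=> e TS e0; have : I_bar Tr 0 (fun T => (\1_E T)%:E) S < e%:E.
    by rewrite nullE// lte_fin.
  move=> /ereal_inf_lt[_ [Vs [Hs [aHs cov ->]]] /ltW].
  rewrite eseries_shift1 => costle.
  exists (fun m => Vs m.+1), (fun m => Hs m.+1); split=> //.
    by move=> m; exact: aHs.
  move=> T TT ET; rewrite -(eseries_shift1 (fun m => liminf_wealth _ _ (Hs m) _)).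
  apply: le_trans (cov T _); last by rewrite node0.
  by rewrite indicE mem_set.
move=> TS; apply/eqP; rewrite eq_le; apply/andP; split; last first.
  apply: le_ereal_inf_tmp => _ [Vs [Hs [aHs _ ->]]]; apply: nneseries_ge0.
  by move=> m m1 _; rewrite lee_fin; exact: admissible_ge0 (aHs _ m1).
apply/lee_addgt0Pr => e e0; rewrite add0e.
have [Vs [Hs [aHs cov]]] := nullE S e TS e0; apply: le_trans.
apply: ereal_inf_lbound; exists (fun m => Vs m.-1), (fun m => Hs m.-1).
rewrite !eseries_shift1; split=> //.
  move=> T; rewrite node0// => TT; rewrite eseries_shift1 /= indicE.
  have [/set_mem ET|_] := boolP (T \in E); first exact: cov.
  by apply: nneseries_ge0 => m _ _; apply: liminf_wealth_ge0 (aHs m) _; rewrite node0.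
Qed.

Lemma I_null_subset E F : I_null Tr E -> F `<=` E -> I_null Tr F.
Proof.
move=> /I_nullP[ETr covE] FE; apply/I_nullP; split.
  exact: subset_trans ETr.
move=> S e TS e0; have [Vs [Hs [aHs cov ?]]] := covE S e TS e0.
by exists Vs, Hs; split=> // T TT /FE; exact: cov.
Qed.

Lemma nneseries_pair (a : nat * nat -> \bar R) (g : nat -> nat * nat) :
  set_bij setT setT g -> (forall x, 0 <= a x) ->
  \sum_(0 <= n <oo) a (g n) = \sum_(0 <= k <oo) \sum_(0 <= l <oo) a (k, l).
Proof.
move=> gbij a0; rewrite nneseries_esumT// -(reindex_esum _ _ _ a gbij).
under eq_eseriesr do rewrite nneseries_esumT//.
rewrite nneseries_esumT; last by move=> n; exact: esum_ge0.
rewrite (esum_esum (a := fun k l => a (k, l)))// (_ : _ `*`` _ = setT).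
  by apply: eq_esum => -[].
by apply/seteqP; split.
Qed.

(** The [k]-th set is superhedged at cost [e / 2 ^ (k + 1)] by countably many
    portfolios, and a pairing of indices turns all of them into one sequence. *)
Lemma I_null_bigcup (E : nat -> set (nat -> R)) :
  (forall k, I_null Tr (E k)) -> I_null Tr (\bigcup_k E k).
Proof.
move=> nullE; apply/I_nullP; split.
  by move=> T [k _]; exact: (nullE k).1.
move=> S e TS e0.
have cov k : covered S (E k) (e / (2 ^ (k + 1))%:R).
  by have /I_nullP[_] := nullE k; apply=> //; rewrite divr_gt0// ltr0n expn_gt0.
have [Vs /choice[Hs covk]] := choice cov.
have [g _ gbij] : exists2 g : nat -> nat * nat, True & set_bij setT setT g.
  by have /card_esym/pcard_eqP[g] := card_nat2; exists g.
exists (fun n => Vs (g n).1 (g n).2), (fun n => Hs (g n).1 (g n).2).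
have aH k l : admissible Tr S 0 (Vs k l) (Hs k l) by case: (covk k).
have V0 k l : 0 <= (Vs k l)%:E by rewrite lee_fin; exact: admissible_ge0 (aH k l).
split=> //.
  move=> T TT [k _ ET]; have [_ /(_ T TT ET) ge1 _] := covk k.
  have w0 p : 0 <= liminf_wealth 0 (Vs p.1 p.2) (Hs p.1 p.2) T.
    by apply: liminf_wealth_ge0 (aH _ _) _; rewrite node0.
  rewrite (nneseries_pair
    (a := fun p => liminf_wealth 0 (Vs p.1 p.2) (Hs p.1 p.2) T) gbij)//=.
  apply: (le_trans ge1).
  pose u i := \sum_(0 <= l <oo) liminf_wealth 0 (Vs i l) (Hs i l) T.
  rewrite -[leLHS]/(u k) -[leRHS]/(\sum_(0 <= i <oo) u i).
  have u0 i : 0 <= u i by apply: nneseries_ge0 => l _ _; exact: (w0 (i, l)).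
  apply: le_trans (nneseries_lim_ge k.+1 _) => //.
  by rewrite big_nat_recr//= leeDr// sume_ge0.
rewrite (nneseries_pair (a := fun p => (Vs p.1 p.2)%:E) gbij)//=.
apply: (@le_trans _ _ (\sum_(0 <= k <oo) (e / (2 ^ (k + 1))%:R)%:E)).
  apply: lee_nneseries => [k _ _|k _]; first by apply: nneseries_ge0.
  by case: (covk k).
have := @cvg_geometric_eseries_half R e 0; rewrite expr0 divr1.
by move=> /cvg_lim<-.
Qed.

Lemma I_null_bigcup_count (I : countType) (E : I -> set (nat -> R)) :
  (forall i, I_null Tr (E i)) -> I_null Tr (\bigcup_i E i).
Proof.
move=> nullE; pose F k := if unpickle k is Some i then E i else set0.
apply: (I_null_subset (E := \bigcup_k F k)); last first.
  by move=> T [i _ ET]; exists (pickle i) => //; rewrite /F pickleK.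
apply: I_null_bigcup => k; rewrite /F; case: unpickle => // {k F nullE}.
apply/I_nullP; split=> // S e TS e0.
exists (fun=> 0%R), (fun _ _ _ => 0%R); split=> //.
  by move=> m; exact: admissible_zero.
by rewrite eseries0// lee_fin ltW.
Qed.

Lemma I_nullU E F : I_null Tr E -> I_null Tr F -> I_null Tr (E `|` F).
Proof.
move=> nE nF; apply: (I_null_subset
  (E := \bigcup_b (if b then E else F))).
  by apply: I_null_bigcup_count => -[].
by move=> T [ET|FT]; [exists true|exists false].
Qed.

Lemma I_null_of_portfolios E : E `<=` Tr ->
  (forall S e, Tr S -> (0 < e)%R -> exists V H,
    [/\ admissible Tr S 0 V H, (V <= e)%R &
        forall T, E T -> \forall n \near \oo, (1 <= wealth 0 n V H T)%R]) ->
  I_null Tr E.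
Proof.
move=> ETr ex; apply/I_nullP; split=> // S e TS e0.
have [V [H [aH Ve w1]]] := ex S e TS e0.
exists (fun m => if m is 0%N then V else 0%R),
  (fun m => if m is 0%N then H else fun _ _ => 0%R); split.
- by case=> // m; exact: admissible_zero.
- move=> T TT /w1 ge1; have ST : node Tr S 0 T by rewrite node0.
  rewrite nneseries_recl//; last first.
    by case=> [|m] _; apply: liminf_wealth_ge0 ST => //; exact: admissible_zero.
  apply: (@le_trans _ _ (liminf_wealth 0 V H T)).
    by apply: limn_einf_ge; near=> n; rewrite lee_fin; near: n.
  rewrite leeDl//; apply: nneseries_ge0 => -[//|m] _ _.
  exact: liminf_wealth_ge0 (admissible_zero _ _ _) ST.
rewrite nneseries_recl//; last first.
  by case=> [|m] _; rewrite lee_fin//; exact: admissible_ge0 aH.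
rewrite [X in _ + X](_ : _ = 0) ?adde0 ?lee_fin//.
by rewrite eseries_cond eseries0// => -[].
Unshelve. all: by end_near. Qed.

(** A wealth that explodes on [E] shows, after scaling it down, that [E] can be
    superhedged at an arbitrarily small cost. *)
Lemma I_null_of_explosion E V H : E `<=` Tr ->
  (forall S, Tr S -> admissible Tr S 0 V H) ->
  (forall T, E T -> wealth 0 n V H T @[n --> \oo] --> +oo%R) ->
  I_null Tr E.
Proof.
move=> ETr aH woo; apply: I_null_of_portfolios => // S e TS e0.
have V0 := admissible_ge0 TS (aH S TS).
have a0 : (0 < e / (V + 1))%R by rewrite divr_gt0// ltr_wpDl.
exists (e / (V + 1) * V)%R, (fun i T => e / (V + 1) * H i T)%R; split.
- exact: admissible_scale (ltW a0) (aH S TS).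
- rewrite mulrAC ler_pdivrMr ?ltr_wpDl// ler_wpM2l ?(ltW e0)//; lra.
move=> T /woo /cvgryPge /(_ ((e / (V + 1))^-1)%R).
apply: filterS => n /=; rewrite wealth_scale => wn.
by rewrite -(ler_pdivrMl _ _ a0) mulr1.
Qed.

(** A free wealth can be scaled up at no cost, so that being eventually bounded
    away from zero is enough. *)
Lemma I_null_of_free_gain E H : E `<=` Tr ->
  (forall S, Tr S -> admissible Tr S 0 0 H) ->
  (forall T, E T -> exists2 d, (0 < d)%R &
     \forall n \near \oo, (d <= wealth 0 n 0 H T)%R) ->
  I_null Tr E.
Proof.
move=> ETr aH gain.
pose F k := [set T | Tr T /\
  \forall n \near \oo, (1 <= k%:R * wealth 0 n 0 H T)%R].
apply: (I_null_subset (E := \bigcup_k F k)).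
  apply: I_null_bigcup => k; apply: I_null_of_portfolios => [T []//|S e TS e0].
  exists (k%:R * 0)%R, (fun i T => k%:R * H i T)%R; split.
  - exact: admissible_scale (aH S TS).
  - by rewrite mulr0 ltW.
  by move=> T [_]; apply: filterS => n; rewrite wealth_scale.
move=> T ET; have [d d0 dw] := gain T ET.
exists (Num.truncn d^-1).+1 => //; split; first exact: ETr.
apply: filterS dw => n dn; apply: le_trans (ler_wpM2l _ dn) => //.
by rewrite -ler_pdivrMr// mul1r ltW// truncnS_gt.
Qed.

End NullSets.

(** * One-step superhedging *)

Section OneStep.
Context {R : realType}.
Variable Tr : set (nat -> R).
Implicit Types (S T : nat -> R) (H : nat -> (nat -> R) -> R) (V : R).

Lemma portfolio_const S j H T : Tr S -> portfolio Tr S j H ->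
  node Tr S j T -> H j T = H j S.
Proof.
move=> TS pH ST; apply: pH => // k.
by rewrite -eqn_leq => /eqP <-; rewrite ST.2.
Qed.

Lemma wealth_one_step S j V H T : Tr S -> portfolio Tr S j H ->
  node Tr S j T ->
  wealth j j.+1 V H T = (V + H j S * (T j.+1 - S j))%R.
Proof.
move=> TS pH ST; rewrite wealthS// wealth0 (portfolio_const TS pH ST).
by rewrite (ST.2 j).
Qed.

(** With an upward and a downward move available, an initial capital covers
    losses of either sign only if the position is at most proportional to it. *)
Lemma up_down_position_bound S j : Tr S -> up_down Tr S j ->
  exists C : R, forall V H, admissible Tr S j V H -> (`|H j S| <= C * V)%R.
Proof.
move=> TS [/ereal_sup_gt[_ [U SU <-] up] /ereal_inf_lt[_ [D SD <-] down]].
rewrite !lte_fin in up down.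
exists ((U j.+1 - S j)^-1 + (S j - D j.+1)^-1)%R => V H aH.
have V0 := admissible_ge0 TS aH.
have wU := admissible_wealth_ge0 aH (leqnSn j) SU.
have wD := admissible_wealth_ge0 aH (leqnSn j) SD.
rewrite (wealth_one_step _ TS aH.1)// in wU.
rewrite (wealth_one_step _ TS aH.1)// in wD.
move: wU wD up down; set h := H j S.
set u := (U j.+1 - S j)%R; rewrite -[(D _ - _)%R]opprB.
set d := (S j - D j.+1)%R => wU wD u0; rewrite oppr_lt0 => d0.
have iu : (0 <= u^-1 * V)%R by rewrite mulr_ge0// invr_ge0 ltW.
have id : (0 <= d^-1 * V)%R by rewrite mulr_ge0// invr_ge0 ltW.
have : (- (u^-1 * V) <= h)%R.
  rewrite lerNl -(ler_pM2l u0) mulrA divff ?gt_eqF// mul1r; lra.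
have : (h <= d^-1 * V)%R.
  rewrite -(ler_pM2l d0) mulrA divff ?gt_eqF// mul1r; lra.
by rewrite ler_norml mulrDl => ? ?; apply/andP; split; lra.
Qed.

(** A superhedge of [g] from the node [(S, j)] bounds [g], at the children where
    (L) holds, by an affine function of the next increment: (L) at the child
    allows one to stop every hedging portfolio on arrival there.  The slopes of
    these portfolios can be summed when the node is up-down, and do not matter
    on flat moves. *)
Lemma one_step_hedge S j (g : (nat -> R) -> R) (x : R) : Tr S ->
  (forall T U, Tr T -> Tr U -> (forall i, (i <= j.+1)%N -> T i = U i) ->
     g T = g U) ->
  sigma_bar Tr j (fun T => (g T)%:E) S < x%:E ->
  exists h : R, forall T, node Tr S j T -> propL Tr T j.+1 ->
    up_down Tr S j \/ T j.+1 = S j ->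
    (g T <= x + h * (T j.+1 - S j))%R.
Proof.
move=> TS g_child /ereal_inf_lt[_ [Vs [Hs [n0 [[pH0 jn0] aHs hedge ->]]]] cost].
have aH m : admissible Tr S j (Vs m.+1) (Hs m.+1) by exact: aHs.
have V0 m : (0 <= Vs m.+1)%R by exact: admissible_ge0 (aH m).
move: cost; rewrite eseries_shift1 => cost.
set v := \sum_(0 <= m <oo) (Vs m.+1)%:E in cost.
have v0 : 0 <= v by apply: nneseries_ge0 => m _ _; rewrite lee_fin.
have voo : v < +oo.
  by rewrite ltNge leye_eq; apply: contraL cost => /eqP ->; rewrite addey// ltNge leey.
have cvgV := cvg_series_of_nneseries V0 voo.
have vfin : v = (fine v)%:E by rewrite fineK// ge0_fin_numE.
rewrite -/v in cvgV; rewrite {}vfin -EFinD lte_fin in cost.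
move: (fine v) cvgV cost => {v0 voo v} v cvgV cost.
have [H0 pH0' H0E] := extend_horizon (Vs 0%N) pH0 jn0.
(* The inequality that (L) leaves at the child [T], where the hedge has been
   carried until time [j + 1] only. *)
have child T : node Tr S j T -> propL Tr T j.+1 ->
    (g T - (Vs 0%N + H0 j S * (T j.+1 - S j)))%:E
      <= \sum_(0 <= m <oo) (Vs m.+1 + Hs m.+1 j S * (T j.+1 - S j))%:E.
  move=> ST LT; have := @propL_subnode _ Tr S j j.+1 (maxn n0 j.+1) T (g T)
    (Vs 0%N) H0 _ _ (leqnSn j) (leq_maxr _ _) ST LT pH0' aH.
  rewrite (wealth_one_step _ TS pH0' ST).
  under eq_eseriesr do rewrite (wealth_one_step _ TS (aH _).1 ST).
  apply=> U TU; have SU : node Tr S j U by exact/(node_trans ST)/(sub_node (leqnSn j)).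
  rewrite (g_child T U ST.1 TU.1); last by move=> i ij; rewrite TU.2.
  rewrite H0E ?leq_maxl// -(eseries_shift1 (fun m => liminf_wealth j (Vs m) (Hs m) U)).
  exact: hedge.
have [ud|nud] := pselect (up_down Tr S j); last first.
  (* On a flat move the positions, summable or not, are multiplied by zero. *)
  exists 0%R => T ST LT [//|TSj]; have := child T ST LT; rewrite TSj subrr.
  under eq_eseriesr do rewrite mulr0 -(mul0r 0%R).
  rewrite (eseries_affine (y := fun=> 0%R) (k := 0%R) 0 cvgV) ?lee_fin; first lra.
  rewrite (_ : series _ = fun=> 0%R); first exact: cvg_cst.
  by apply/funext => n; rewrite /series /= big1.
have [C slope] := up_down_position_bound TS ud.
have /normed_cvg/cvg_ex[/= k cvgH] : cvgn [normed series (fun m => Hs m.+1 j S)].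
  apply: (series_le_cvg (v_ := fun m => C * Vs m.+1)%R) => [m||m|].
  - exact: normr_ge0.
  - by move=> m; apply: le_trans (slope _ _ (aH m)); exact: normr_ge0.
  - exact: slope.
  rewrite (_ : series _ = (fun n => C * series (fun m => Vs m.+1) n)%R).
    by apply/cvg_ex; exists (C * v)%R; exact: cvgMr.
  by apply/funext => n; rewrite /series /= mulr_sumr.
exists (H0 j S + k)%R => T ST LT _; have := child T ST LT.
rewrite (eseries_affine (y := fun m => Hs m.+1 j S) _ cvgV cvgH) lee_fin; lra.
Qed.
End OneStep.

(** * Trading on a supermartingale *)

Section Trading.
Context {R : realType}.
Variable (s0 : R) (Tr : set (nat -> R)).
Hypothesis Tr_s0 : forall S, Tr S -> S 0%N = s0.
Hypothesis Tr_cond : forall S j, Tr S -> up_down Tr S j ->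
  propL Tr S j -> ~ propL Tr S j.+1 ->
  exists S1 S0 : nat -> R,
    [/\ node Tr S j S1, node Tr S j S0,
        (S0 j.+1 <= S j.+1 <= S1 j.+1)%R,
        propL Tr S1 j.+1 & propL Tr S0 j.+1].
Variable g : nat -> (nat -> R) -> R.
Hypothesis g_na : forall j S T, Tr S -> Tr T ->
  (forall i, (i <= j)%N -> S i = T i) -> g j S = g j T.
Hypothesis g_ge0 : forall j S, Tr S -> (0 <= g j S)%R.
Implicit Types (S T : nat -> R) (H : nat -> (nat -> R) -> R) (V : R).

Definition fair_node S j : Prop :=
  propL Tr S j /\ sigma_bar Tr j (fun T => (g j.+1 T)%:E) S <= (g j S)%:E.

Definition hedging_position S j (e h : R) : Prop :=
  (forall T, node Tr S j T -> propL Tr T j.+1 ->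
     up_down Tr S j \/ T j.+1 = S j ->
     (g j.+1 T <= g j S + e + h * (T j.+1 - S j))%R) /\
  (forall T, node Tr S j T -> (0 <= g j S + e + h * (T j.+1 - S j))%R).

(** At the children where (L) fails the affine bound is only known to be
    nonnegative: they lie between two children where it dominates [g]. *)
Lemma hedging_position_exists S j (e : R) : Tr S -> fair_node S j ->
  (0 < e)%R -> exists h, hedging_position S j e h.
Proof.
move=> TS [LS super] e0.
have [||h hedge] := @one_step_hedge _ Tr S j (g j.+1) (g j S + e)%R TS.
- by move=> T U; exact: g_na.
- by apply: le_lt_trans super _; rewrite lte_fin ltrDl.
have gSe : (0 <= g j S + e)%R by rewrite addr_ge0 ?g_ge0// ltW.
have [ud|nud] := pselect (up_down Tr S j); last first.
  exists 0%R; split=> T ST; last by rewrite mul0r addr0.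
  move=> LT [//|TSj]; have := hedge T ST LT (or_intror TSj).
  by rewrite TSj subrr !mulr0.
exists h; split=> [|T ST]; first exact: hedge.
have ge0 U : node Tr S j U -> propL Tr U j.+1 ->
    (0 <= g j S + e + h * (U j.+1 - S j))%R.
  move=> SU LU; apply: le_trans (hedge U SU LU (or_introl ud)).
  exact: g_ge0 SU.1.
have [LT|nLT] := pselect (propL Tr T j.+1); first exact: ge0.
have nodeT := node_eq ST (leqnn j).
have [||S1 [S0 [TS1 TS0 /andP[S0T TS1'] L1 L0]]] := Tr_cond ST.1 _ _ nLT.
- by rewrite (up_down_node nodeT)//; exact: ST.2.
- by rewrite (propL_node nodeT).
have := ge0 S1 (node_trans ST TS1) L1.
have := ge0 S0 (node_trans ST TS0) L0.
(* The affine bound is smallest at the lower neighbour [S0] when [0 <= h], and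
   at the upper neighbour [S1] otherwise. *)
have [h0|/ltW h0] := leP 0%R h.
  have := ler_wpM2l h0 S0T; lra.
have := ler_wnM2l h0 TS1'; lra.
Qed.

Definition tolerance j : R := (2 ^- j.+1)%R.

Lemma tolerance_gt0 j : (0 < tolerance j)%R.
Proof. by rewrite invr_gt0 exprn_gt0. Qed.

(** The choice is made from a set that depends on the node only, and is therefore
    non-anticipative. *)
Definition position j S : R :=
  xget 0%R [set h | hedging_position S j (tolerance j) h].

Lemma positionP S j : Tr S -> fair_node S j ->
  hedging_position S j (tolerance j) (position j S).
Proof.
move=> TS fS; have [h hP] := hedging_position_exists TS fS (tolerance_gt0 j).
by rewrite /position; case: xgetP => // /(_ h).
Qed.

(** The flat moves forced at the earlier nodes are part of the condition, so
    that once it fails it fails for good and trading stops. *)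
Definition regular n S : Prop :=
  forall i, (i <= n)%N ->
    fair_node S i /\ ((i < n)%N -> up_down Tr S i \/ S i.+1 = S i).

Lemma regularS n S : regular n.+1 S -> regular n S.
Proof.
move=> reg i le_in; have [fS step] := reg i (leqW le_in); split=> // _.
exact: step.
Qed.

Lemma regular_node n S T : Tr S -> node Tr S n T -> regular n S -> regular n T.
Proof.
move=> TS ST reg i le_in; have [[LS super] step] := reg i le_in.
have nodeT := node_eq ST le_in.
split=> [|lt_in].
  split; first by rewrite (propL_node nodeT).
  rewrite (sigma_bar_node nodeT) (g_na (S := T) (T := S) ST.1)// => k ki.
  by rewrite ST.2// (leq_trans ki).
rewrite (up_down_node nodeT) ?ST.2//; exact: step.
Qed.

Lemma position_node j S T : Tr S -> node Tr S j T -> position j T = position j S.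
Proof.
move=> TS ST; rewrite /position; congr xget.
have nodeT := node_eq ST (leqnn j); have Tj := ST.2 j (leqnn j).
apply/funext => h; rewrite /mkset /hedging_position (up_down_node nodeT)//.
by rewrite nodeT Tj (g_na (S := T) (T := S) ST.1)//; exact: ST.2.
Qed.

Section HoldingRule.
(** [hold n] says whether the supermartingale is held between the times [n] and
    [n + 1]. *)
Variable hold : nat -> (nat -> R) -> bool.
Hypothesis hold_na : forall j S T, Tr S -> Tr T ->
  (forall i, (i <= j)%N -> S i = T i) -> hold j S = hold j T.

Definition gain n S : R :=
  (\sum_(i < n) (hold i S)%:R * (g i.+1 S - g i S))%R.

Definition strategy i S : R :=
  if `[< regular i S >] then ((hold i S)%:R * position i S)%R else 0%R.

Lemma strategy_portfolio S : Tr S -> portfolio Tr S 0 strategy.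
Proof.
move=> TS i T T' _ ST ST' TT'.
have nTT' : node Tr T i T' by split; [exact: ST'.1|move=> k ki; rewrite TT'].
have nT'T : node Tr T' i T by split; [exact: ST.1|move=> k ki; rewrite TT'].
rewrite /strategy (position_node ST.1 nTT').
rewrite (hold_na (S := T) (T := T') ST.1 ST'.1) => [|k ki]; last by rewrite TT'.
congr (if _ then _ else _); apply: asbool_equiv_eq.
by split; apply: regular_node => //; [exact: ST.1|exact: ST'.1].
Qed.

(** With the capital [c], the gain never leads into debt, and whenever the
    supermartingale is held its current price is covered.  Since the price
    stays nonnegative, the wealth then survives a step to a node that is not
    regular. *)
Variable c : R.
Hypothesis covered_gain : forall n S, Tr S -> (0 <= c + gain n S)%R.
Hypothesis covered_hold : forall n S, Tr S -> hold n S ->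
  (g n S <= c + gain n S)%R.

(** The tolerances not yet spent at time [n] add up to [2 ^- n]; they are the
    part of the wealth that is kept on top of the gain. *)
Lemma strategy_wealth n S : Tr S ->
  (0 <= wealth 0 n (c + 1) strategy S)%R /\
  (regular n S -> (c + gain n S + 2 ^- n <= wealth 0 n (c + 1) strategy S)%R).
Proof.
move=> TS; elim: n => [|n [IHpos IHreg]].
  rewrite wealth0 /gain big_ord0 expr0 invr1 addr0; split=> //.
  by have := covered_gain 0 TS; rewrite /gain big_ord0; lra.
rewrite wealthS//; set W := wealth _ _ _ _ _ in IHpos IHreg *.
have gainS : gain n.+1 S = (gain n S + (hold n S)%:R * (g n.+1 S - g n S))%R.
  by rewrite /gain big_ord_recr.
have half : (2 ^- n = tolerance n + 2 ^- n.+1 :> R)%R.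
  by rewrite /tolerance exprS invfM; field.
have pos : (0 < tolerance n)%R := tolerance_gt0 n.
have pos' : (0 < 2 ^- n.+1 :> R)%R := pos.
rewrite /strategy; case: asboolP => [reg|nreg]; last first.
  by rewrite mul0r addr0; split=> // /regularS.
have [fS _] := reg n (leqnn n).
have [hedge hedge0] := positionP TS fS.
have {IHreg}Wn := IHreg reg.
have nSS : node Tr S n S by exact: node_self.
case: (boolP (hold n S)) gainS => [/(covered_hold TS) gn|_] ->; last first.
  by rewrite !mul0r !addr0; split=> // _; lra.
rewrite !mul1r; have := hedge0 S nSS; split; first lra.
move=> regS; have [[LS _] _] := regS n.+1 (leqnn _).
have [_ /(_ (ltnSn n)) step] := regS n (leqW (leqnn n)).
have := hedge S nSS LS step; lra.
Qed.

Lemma strategy_admissible S : Tr S -> admissible Tr S 0 (c + 1) strategy.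
Proof.
move=> TS; apply: admissibleP; first exact: strategy_portfolio.
by move=> n T _ ST; have [] := strategy_wealth n ST.1.
Qed.

Lemma I_null_gain_explosion : I_null Tr
  [set S | [/\ Tr S, forall n, regular n S & gain n S @[n --> \oo] --> +oo%R]].
Proof.
apply: (I_null_of_explosion (V := (c + 1)%R) (H := strategy) Tr_s0).
- by move=> S [].
- exact: strategy_admissible.
move=> S [TS reg goo]; apply/cvgryPge => A.
move/cvgryPge : goo => /(_ (A - c)%R); apply: filterS => n An.
have [_ /(_ (reg n))] := strategy_wealth n TS; apply: le_trans.
have : (0 < 2 ^- n :> R)%R by rewrite invr_gt0 exprn_gt0.
lra.
Qed.

End HoldingRule.
End Trading.

(** * Moves from nodes that are not up-down *)

Section OneSidedNodes.
Context {R : realType}.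
Variable (s0 : R) (Tr : set (nat -> R)).
Hypothesis Tr_s0 : forall S, Tr S -> S 0%N = s0.
Implicit Types (S T : nat -> R).

(** One unit bet in the only direction in which the next move can go. *)
Definition one_sided_bet i S : R :=
  if `[< up_down Tr S i >] then 0%R
  else if `[< forall T, node Tr S i T -> (S i <= T i.+1)%R >] then 1%R
  else (-1)%R.

Lemma one_sided_bet_gain i S : Tr S ->
  (one_sided_bet i S * (S i.+1 - S i))%R =
  if `[< up_down Tr S i >] then 0%R else `|(S i.+1 - S i)%R|%R.
Proof.
move=> TS; rewrite /one_sided_bet; case: asboolP => [|nud]; first by rewrite mul0r.
have SS : node Tr S i S by exact: node_self.
case: asboolP => [ge|nge]; first by rewrite mul1r ger0_norm// subr_ge0 ge.
rewrite mulN1r ler0_norm// subr_le0 leNgt; apply/negP => lt.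
apply: nge => T ST; rewrite leNgt; apply/negP => gt; apply: nud; split.
  apply: (@lt_le_trans _ _ (S i.+1 - S i)%:E); first by rewrite lte_fin subr_gt0.
  by apply: ereal_sup_ubound; exists S.
apply: (@le_lt_trans _ _ (T i.+1 - S i)%:E); last by rewrite lte_fin subr_lt0.
by apply: ereal_inf_lbound; exists T.
Qed.

Lemma one_sided_bet_portfolio S : Tr S -> portfolio Tr S 0 one_sided_bet.
Proof.
move=> TS i T T' _ ST ST' TT'.
have nTT' : node Tr T i T' by split; [exact: ST'.1|move=> k ki; rewrite TT'].
have E := node_eq nTT' (leqnn i).
by rewrite /one_sided_bet (up_down_node E) -?TT' ?leqnn// E.
Qed.

Lemma one_sided_wealth_ge n i S : Tr S -> (i < n)%N ->
  ((if `[< up_down Tr S i >] then 0 else `|S i.+1 - S i|)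
    <= wealth 0 n 0 one_sided_bet S)%R.
Proof.
move=> TS lt_in; rewrite /wealth add0r.
under eq_bigr do rewrite one_sided_bet_gain//.
rewrite (bigD1_seq i) ?mem_index_iota ?iota_uniq//= lerDl.
by apply: sumr_ge0 => k _; case: asboolP.
Qed.

(** A node that is not up-down offers a free gain on every move that is not
    flat. *)
Lemma I_null_one_sided_moves : I_null Tr
  [set S | Tr S /\ exists i, ~ up_down Tr S i /\ S i.+1 <> S i].
Proof.
apply: (I_null_of_free_gain (H := one_sided_bet) Tr_s0) => [S []//|S TS|S].
  apply: admissibleP => [|n T _ ST]; first exact: one_sided_bet_portfolio.
  case: n => [|n]; first by rewrite wealth0.
  apply: le_trans (one_sided_wealth_ge ST.1 (ltnSn n)).
  by case: asboolP.
move=> [TS [i [nud /eqP move_i]]]; exists `|S i.+1 - S i|%R.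
  by rewrite normr_gt0 subr_eq0.
exists i.+1 => // n /= lt_in; apply: le_trans (one_sided_wealth_ge TS lt_in).
by case: asboolP.
Qed.

End OneSidedNodes.

(** * Upcrossings of a real sequence *)

Section Upcrossings.
Context {R : realType}.
Implicit Types (x y : R^nat) (a b c : R).

(** Whether the rule that buys below [a] and sells above [b] is holding after
    time [n], with the number of completed sales. *)
Fixpoint crossing a b x n : bool * nat :=
  if n is n'.+1 then
    let: (held, k) := crossing a b x n' in
    if held then if (b <= x n)%R then (false, k.+1) else (true, k)
    else ((x n <= a)%R, k)
  else ((x 0%N <= a)%R, 0%N).

Lemma eq_crossing a b x y n : (forall i, (i <= n)%N -> x i = y i) ->
  crossing a b x n = crossing a b y n.
Proof.
elim: n => [|n IH] xy /=; first by rewrite xy.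
by rewrite IH ?xy// => i ile; rewrite xy// leqW.
Qed.

Definition crossing_gain a b x n : R :=
  (\sum_(i < n) (crossing a b x i).1%:R * (x i.+1 - x i))%R.

(** Every completed sale has earned at least [b - a]; a pending purchase was made
    at a price of at most [a], so it is worth at least [x n - a] at time [n]. *)
Lemma crossing_gain_ge a b x n :
  ((b - a) * (crossing a b x n).2%:R
    + (if (crossing a b x n).1 then x n - a else 0) <= crossing_gain a b x n)%R.
Proof.
elim: n => [|n]; rewrite /crossing_gain.
  by rewrite big_ord0 /= mulr0 add0r; case: ifP => //; rewrite subr_le0.
rewrite big_ord_recr /=; move: (\sum_(i < n) _)%R => D.
case: (crossing a b x n) => -[] k /= IH.
  case: ifP => bx /=; last by lra.
  by rewrite -natr1; lra.
by case: ifP => xa; lra.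
Qed.

Lemma crossing_gain_covered a b x n : (forall i, (0 <= x i)%R) -> (a <= b)%R ->
  (0 <= `|a| + crossing_gain a b x n)%R /\
  ((crossing a b x n).1 -> (x n <= `|a| + crossing_gain a b x n)%R).
Proof.
move=> x0 ab; have := crossing_gain_ge a b x n; have := x0 n.
have := ler_norm a; have := normr_ge0 a.
have : (0 <= (b - a) * (crossing a b x n).2%:R)%R by rewrite mulr_ge0// subr_ge0.
by case: (crossing a b x n).1 => *; split=> //; lra.
Qed.

Lemma crossing_low a b x n : (a < b)%R -> (x n <= a)%R -> (crossing a b x n).1.
Proof.
move=> ab xa; case: n xa => [//|n] xa /=; case: (crossing a b x n) => -[] k //.
by rewrite leNgt (le_lt_trans xa ab).
Qed.

Lemma crossing_high a b x n : (a < b)%R -> (b <= x n)%R ->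
  ~~ (crossing a b x n).1.
Proof.
move=> ab bx; case: n bx => [|n] bx /=; first by rewrite -ltNge (lt_le_trans ab).
case: (crossing a b x n) => -[] k /=; first by rewrite bx.
by rewrite -ltNge (lt_le_trans ab).
Qed.

Lemma crossing_count_mono a b x :
  {homo (fun n => (crossing a b x n).2) : m n / (m <= n)%N}.
Proof.
apply: homo_leq => [//|p m n|n]; first exact: leq_trans.
by rewrite /=; case: (crossing a b x n) => -[] k //=; case: ifP.
Qed.

Lemma crossing_count_lt a b x m n : (m <= n)%N -> (crossing a b x m).1 ->
  ~~ (crossing a b x n).1 -> ((crossing a b x m).2 < (crossing a b x n).2)%N.
Proof.
move=> mn held; elim: n mn => [|n IH].
  by rewrite leqn0 => /eqP m0; rewrite -m0 held.
rewrite leq_eqVlt ltnS => /orP[/eqP<-|mn]; first by rewrite held.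
have := IH mn; have := crossing_count_mono a b x mn; rewrite /=.
case: (crossing a b x n) => -[] k /= mk IHn; first by case: ifP.
by move=> _; exact: IHn.
Qed.

Lemma crossing_gain_cvgy a b x : (a < b)%R -> (forall i, (0 <= x i)%R) ->
  (forall N, exists2 n, (N <= n)%N & (x n <= a)%R) ->
  (forall N, exists2 n, (N <= n)%N & (b <= x n)%R) ->
  crossing_gain a b x n @[n --> \oo] --> +oo%R.
Proof.
move=> ab x0 low high.
have many K : exists n, (K <= (crossing a b x n).2)%N.
  elim: K => [|K [n Kn]]; first by exists 0%N.
  have [m nm /(crossing_low ab) held] := low n.
  have [p mp /(crossing_high ab) sold] := high m.
  exists p; apply: leq_trans (crossing_count_lt mp held sold).
  exact: leq_trans Kn (crossing_count_mono a b x nm).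
apply/cvgryPge => A; have [N AN] := many (Num.truncn ((A + `|a|) / (b - a))).+1.
exists N => // n /= Nn; have := crossing_gain_ge a b x n; have := x0 n.
have := ler_norm a; have := normr_ge0 a.
have : ((A + `|a|) / (b - a) <= (crossing a b x n).2%:R)%R.
  apply: le_trans (ltW (truncnS_gt _)) _; rewrite ler_nat.
  exact: leq_trans AN (crossing_count_mono a b x Nn).
rewrite ler_pdivrMr ?subr_gt0// mulrC.
by case: (crossing a b x n).1; lra.
Qed.

(** Between distinct lower and upper limits lie two rationals, and the sequence
    crosses the interval between them infinitely often. *)
Lemma cvg_of_no_upcrossing x :
  (forall i, (0 <= x i)%R) ->
  ~ (x n @[n --> \oo] --> +oo%R) ->
  (forall p q : rat, (p < q)%R ->
     (forall N, exists2 n, (N <= n)%N & (x n <= ratr p)%R) ->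
     (forall N, exists2 n, (N <= n)%N & (ratr q <= x n)%R) -> False) ->
  exists l : R, x n @[n --> \oo] --> l.
Proof.
move=> x0 nxoo nocross; pose u n := (x n)%:E.
have u_ge0 : 0 <= limn_einf u.
  by apply: limn_einf_ge; apply: nearW => n; rewrite lee_fin.
have low (r : R) : limn_einf u < r%:E ->
    forall N, exists2 n, (N <= n)%N & (x n <= r)%R.
  rewrite limn_einf_lim (cvg_lim _ (@cvg_einfs_sup _ u))// => ur N.
  have : einfs u N < r%:E.
    by apply: le_lt_trans ur; apply: ereal_sup_ubound; exists N.
  move=> /ereal_inf_lt[_ [n /= Nn <-]]; rewrite lte_fin => /ltW xr.
  by exists n.
have high (r : R) : r%:E < limn_esup u ->
    forall N, exists2 n, (N <= n)%N & (r <= x n)%R.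
  rewrite limn_esup_lim (cvg_lim _ (@cvg_esups_inf _ u))// => ur N.
  have : r%:E < esups u N.
    by apply: lt_le_trans ur _; apply: ereal_inf_lbound; exists N.
  move=> /ereal_sup_gt[_ [n /= Nn <-]]; rewrite lte_fin => /ltW xr.
  by exists n.
have eq_lim : limn_esup u <= limn_einf u.
  rewrite leNgt; apply/negP => lt_lim.
  have [a ua] : exists a, limn_einf u = a%:E.
    exists (fine (limn_einf u)); rewrite fineK// ge0_fin_numE//.
    exact: lt_le_trans lt_lim (leey _).
  have [t a_lt_t t_le] : exists2 t, (a < t)%R & t%:E <= limn_esup u.
    move: lt_lim; rewrite ua; case: (limn_esup u) => [t|_|//].
      by rewrite lte_fin; exists t.
    by exists (a + 1)%R; rewrite ?ltrDl// leey.
  have [p] := rat_in_itvoo a_lt_t; rewrite in_itv /= => /andP[a_lt_p p_lt_t].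
  have [q] := rat_in_itvoo p_lt_t; rewrite in_itv /= => /andP[p_lt_q q_lt_t].
  apply: (nocross p q); first by rewrite -(ltr_rat R).
    by apply: low; rewrite ua lte_fin.
  by apply: high; apply: lt_le_trans t_le; rewrite lte_fin.
have ucvg : u n @[n --> \oo] --> limn_einf u.
  apply: (@squeeze_cvge _ _ _ _ (einfs u) _ (esups u)).
  - apply: nearW => n; apply/andP; split.
      by apply: ereal_inf_lbound; exists n => /=.
    by apply: ereal_sup_ubound; exists n => /=.
  - by rewrite limn_einf_lim; exact: is_cvg_einfs.
  have /eqP <- : limn_esup u == limn_einf u by rewrite eq_le eq_lim limn_einf_sup.
  by rewrite limn_esup_lim; exact: is_cvg_esups.
move: u_ge0 ucvg; case: (limn_einf u) => [l _|_|//].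
  by move=> /fine_cvgP[_ xl]; exists l.
by move=> /cvgeyPge uoo; exfalso; apply: nxoo; apply/cvgryPge.
Qed.

End Upcrossings.

(** * Convergence of supermartingales *)

Section Convergence.
Context {R : realType}.
Variable (s0 : R) (Tr : set (nat -> R)).
Hypothesis Tr_s0 : forall S, Tr S -> S 0%N = s0.
Hypothesis Lae : L_ae Tr.
Hypothesis Tr_cond : forall S j, Tr S -> up_down Tr S j ->
  propL Tr S j -> ~ propL Tr S j.+1 ->
  exists S1 S0 : nat -> R,
    [/\ node Tr S j S1, node Tr S j S0,
        (S0 j.+1 <= S j.+1 <= S1 j.+1)%R,
        propL Tr S1 j.+1 & propL Tr S0 j.+1].
Variable g : nat -> (nat -> R) -> R.
Hypothesis g_na : forall j S T, Tr S -> Tr T ->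
  (forall i, (i <= j)%N -> S i = T i) -> g j S = g j T.
Hypothesis g_ge0 : forall j S, Tr S -> (0 <= g j S)%R.
Hypothesis g_super : forall j, I_ae Tr (fun S =>
  sigma_bar Tr j (fun T => (g j.+1 T)%:E) S <= (g j S)%:E).
Implicit Types (S T : nat -> R).

Lemma I_ae_regular : I_ae Tr (fun S => forall n, regular Tr g n S).
Proof.
have nL := Lae.2; have nF := I_null_bigcup Tr_s0 g_super.
have nM := I_null_one_sided_moves Tr_s0.
apply: (I_null_subset Tr_s0 (I_nullU Tr_s0 (I_nullU Tr_s0 nL nF) nM)).
move=> S [TS nreg]; apply: contrapT => /not_orP[/not_orP[okL okF] okM].
apply: nreg => n i _; split=> [|_].
  split; apply: contrapT => bad; [apply: okL|apply: okF].
    by split=> // /(_ i).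
  by exists i.
have [|nud] := pselect (up_down Tr S i); first by left.
right; apply: contrapT => move_i; apply: okM.
by split=> //; exists i.
Qed.

Lemma I_null_upcrossings (a b : R) : (a < b)%R -> I_null Tr
  [set S | [/\ Tr S, forall n, regular Tr g n S,
     forall N, exists2 n, (N <= n)%N & (g n S <= a)%R &
     forall N, exists2 n, (N <= n)%N & (b <= g n S)%R]].
Proof.
move=> ab; pose hold n S := (crossing a b (fun i => g i S) n).1.
have cov n S (TS : Tr S) := crossing_gain_covered n (fun i => g_ge0 i TS) (ltW ab).
apply: (I_null_subset Tr_s0 (I_null_gain_explosion Tr_s0 Tr_cond g_na g_ge0
  (hold := hold) _ (c := `|a|%R) _ _)).
- move=> j S T TS TT ST; rewrite /hold (@eq_crossing _ _ _ _ (fun i => g i T))//.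
  by move=> i ij; apply: g_na => // k ki; rewrite ST// (leq_trans ki).
- by move=> n S TS; case: (cov n S TS).
- by move=> n S TS; case: (cov n S TS).
move=> S [TS reg low high]; split=> //.
by apply: crossing_gain_cvgy high => //= i; exact: g_ge0.
Qed.

(** All trajectories start at the same point, so that the price of holding the
    supermartingale from the start on is a constant. *)
Lemma I_null_divergence : I_null Tr
  [set S | [/\ Tr S, forall n, regular Tr g n S &
                     g n S @[n --> \oo] --> +oo%R]].
Proof.
pose g0 := g 0 (xget (fun=> 0%R) Tr).
have g0E S : Tr S -> g 0 S = g0.
  move=> TS; apply: g_na => //; first by apply: xgetPex; exists S.
  move=> i; rewrite leqn0 => /eqP->.
  by rewrite !Tr_s0//; apply: xgetPex; exists S.
have gainE n S : gain g (fun _ _ => true) n S = (g n S - g 0 S)%R.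
  rewrite /gain; under eq_bigr do rewrite mul1r.
  by rewrite -(big_mkord xpredT (fun i => g i.+1 S - g i S)%R) telescope_sumr.
apply: (I_null_subset Tr_s0 (I_null_gain_explosion Tr_s0 Tr_cond g_na g_ge0
  (hold := fun _ _ => true) _ (c := g0) _ _)) => //.
- by move=> n S TS; rewrite gainE -(g0E S)// addrC subrK g_ge0.
- by move=> n S TS _; rewrite gainE -(g0E S)// addrC subrK.
move=> S [TS reg goo]; split=> //; apply/cvgryPge => A.
move/cvgryPge : goo => /(_ (A + g 0 S)%R); apply: filterS => n.
by rewrite gainE lerBrDr.
Qed.

(** Countably many intervals, those with rational ends, suffice to detect
    oscillation. *)
Lemma supermartingale_cvg_ae :
  I_ae Tr (fun S => exists l : R, g n S @[n --> \oo] --> l).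
Proof.
pose U (pq : rat * rat) := [set S | (pq.1 < pq.2)%R /\
  [/\ Tr S, forall n, regular Tr g n S,
     forall N, exists2 n, (N <= n)%N & (g n S <= ratr pq.1)%R &
     forall N, exists2 n, (N <= n)%N & (ratr pq.2 <= g n S)%R]].
have nU : I_null Tr (\bigcup_pq U pq).
  apply: (I_null_bigcup_count Tr_s0) => -[p q].
  have [lt_pq|ge_pq] := boolP (p < q)%R.
    have lt_pqR : (ratr p < ratr q :> R)%R by rewrite ltr_rat.
    by apply: (I_null_subset Tr_s0 (I_null_upcrossings lt_pqR)) => S [].
  by apply: (I_null_subset Tr_s0 I_null_divergence) => S [/=]; rewrite (negbTE ge_pq).
apply: (I_null_subset Tr_s0
  (I_nullU Tr_s0 (I_nullU Tr_s0 I_ae_regular nU) I_null_divergence)).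
move=> S [TS ncvg]; apply: contrapT => /not_orP[/not_orP[okR okU] okD].
have reg : forall n, regular Tr g n S.
  by apply: contrapT => nreg; apply: okR.
apply: ncvg; apply: cvg_of_no_upcrossing => [i||p q lt_pq low high].
- exact: g_ge0.
- by move=> goo; apply: okD.
by apply: okU; exists (p, q).
Qed.

End Convergence.

Unset Implicit Arguments.

Theorem theorem5p1 (R : realType) (s0 : R) (Tr : set (nat -> R))
    (Tr_s0 : forall S, Tr S -> S 0%N = s0)
    (Lae : L_ae Tr)
    (f : nat -> (nat -> R) -> \bar R)
    (f_super : supermartingale Tr f)
    (f_range : forall i S, Tr S -> 0 <= f i S < +oo)
    (Tr_cond : forall S j, Tr S -> up_down Tr S j ->
       propL Tr S j -> ~ propL Tr S j.+1 ->
       exists S1 S0 : nat -> R,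
         [/\ node Tr S j S1, node Tr S j S0,
             (S0 j.+1 <= S j.+1 <= S1 j.+1)%R,
             propL Tr S1 j.+1 & propL Tr S0 j.+1]) :
  exists Ndiv : set (nat -> R), I_null Tr Ndiv /\
    forall S, Tr S -> ~ Ndiv S ->
      exists l : R, (fun i => f i S) @ \oo --> l%:E.
Proof.
have fE i S : Tr S -> (fine (f i S))%:E = f i S.
  by move=> TS; have /andP[f0 foo] := f_range i S TS; rewrite fineK// ge0_fin_numE.
have sigmaE j S :
    sigma_bar Tr j (fun T => (fine (f j.+1 T))%:E) S = sigma_bar Tr j (f j.+1) S.
  congr ereal_inf; apply/seteqP; split=> _ [Vs [Hs [n0 [pH aHs hedge ->]]]];
    exists Vs, Hs, n0; split=> // T ST; have := hedge T ST; rewrite fE//; exact: ST.1.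
have := @supermartingale_cvg_ae R s0 Tr Tr_s0 Lae Tr_cond (fun i S => fine (f i S)).
case=> [j S T TS TT ST|j S TS|j|nTr null].
- by rewrite (f_super.1 j S T).
- by have /andP[] := f_range j S TS; case: (f j S).
- apply: (I_null_subset Tr_s0 (f_super.2 j)) => S [TS].
  by rewrite sigmaE fE.
exists [set S | Tr S /\ ~ exists l : R, fine (f n S) @[n --> \oo] --> l].
split=> // S TS /not_andP[//|/contrapT[l fl]]; exists l.
rewrite (_ : (fun i => f i S) = fun i => (fine (f i S))%:E).
  by apply: cvg_EFin => //; exact: nearW.
by apply/funext => i; rewrite fE.
Qed.
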